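(* Let $d\ge 1$ and $n\ge 2$ be integers, let $\mathcal{D}\subset\{0,1,\dots,n-1\}^d$ be a non-empty digit set, and let $E=E(n,\mathcal{D})\subset\mathbb{R}^d$ be the associated fractal cube. If $E$ has a trivial point, then $$\mathcal{I}_c(E)<\dim_H E.$$
   Context: The fractal cube $E=E(n,\mathcal{D})$ is the unique non-empty compact set $E\subset\mathbb{R}^d$ satisfying $E=\frac1n(E+\mathcal{D})$, i.e. the attractor of the IFS $\{z\mapsto \frac1n(z+h)\}_{h\in\mathcal{D}}$. For a metric space $K$, a point $x\in K$ is a trivial point of $K$ if $\{x\}$ is a connected component of $K$; $\Lambda(K)$ denotes the set of trivial points of $K$. The connectedness index of $K$ is $\mathcal{I}_c(K):=\dim_H(K\setminus\Lambda(K))$, where $\dim_H$ is the Hausdorff dimension, with the convention $\dim_H\emptyset=-1$. *)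

(* Defs.v *)
From HB Require Import structures.
From mathcomp Require Export all_boot all_order all_algebra.
From mathcomp Require Export all_classical all_reals all_analysis.
Export Order.TTheory GRing.Theory Num.Theory numFieldNormedType.Exports.

Set Implicit Arguments.
Unset Strict Implicit.
Unset Printing Implicit Defensive.

Local Open Scope classical_set_scope.
Local Open Scope ring_scope.

(* The norm carried by 'rV[R]_d in the library is the sup norm, so the
   Euclidean metric is written out; both induce the same topology. *)
Definition eucl_dist (R : realType) (d : nat) (x y : 'rV[R]_d) : R :=
  Num.sqrt (\sum_(i < d) (x ord0 i - y ord0 i) ^+ 2).

(* -oo on the empty set *)
Definition diam (R : realType) (d : nat) (U : set 'rV[R]_d) : \bar R :=
  ereal_sup [set (eucl_dist p.1 p.2)%:E | p in U `*` U].

(* |U|^s, with |set0|^s = 0 for every s, and 0^0 = 1 on non-empty sets, so that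
   the 0-dimensional Hausdorff measure is the counting measure. *)
Definition hausdorff_weight (R : realType) (d : nat) (s : R)
    (U : set 'rV[R]_d) : \bar R :=
  if U == set0 then 0%E else (diam U `^ s)%E.

Definition hausdorff_premeasure (R : realType) (d : nat) (s delta : R)
    (A : set 'rV[R]_d) : \bar R :=
  ereal_inf [set (\sum_(0 <= i <oo) hausdorff_weight s (U i))%E |
    U in [set U : nat -> set 'rV[R]_d |
            A `<=` \bigcup_i U i /\ forall i, (diam (U i) <= delta%:E)%E]].

Definition hausdorff_measure (R : realType) (d : nat) (s : R)
    (A : set 'rV[R]_d) : \bar R :=
  ereal_sup [set hausdorff_premeasure s delta A |
    delta in [set delta : R | 0 < delta]].

Definition hausdorff_dim (R : realType) (d : nat) (A : set 'rV[R]_d) : \bar R :=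
  if A == set0 then (-1)%:E
  else ereal_inf [set s%:E |
    s in [set s : R | 0 <= s /\ hausdorff_measure s A = 0%E]].

(* If x is not in K then connected_component K x is empty, so trivial points
   of K belong to K. *)
Definition trivial_points (T : topologicalType) (K : set T) : set T :=
  [set x | connected_component K x = [set x]].

Definition connectedness_index (R : realType) (d : nat)
    (K : set 'rV[R]_d) : \bar R :=
  hausdorff_dim (K `\` trivial_points K).

Definition digit_vec (R : realType) (d n : nat) (h : 'rV['I_n]_d) : 'rV[R]_d :=
  map_mx (fun k : 'I_n => (k : nat)%:R) h.

(* E is the attractor E(n, D), characterised (by Hutchinson's theorem, uniquely)
   as a non-empty compact set with E = (E + D) / n. *)
Definition fractal_cube (R : realType) (d n : nat) (D : {set 'rV['I_n]_d})
    (E : set 'rV[R]_d) : Prop :=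
  [/\ E !=set0, compact E &
    E = \bigcup_(h in [set` D])
          [set n%:R^-1 *: (z + digit_vec R h) | z in E]].

(* Main.v *)
(** Let N be the number of digits.  A trivial point [x] has arbitrarily small
    clopen neighbourhoods, here the sets of points reachable from [x] by
    e-chains in [E].  Take [x] trivial with the fewest coordinates in {0, 1}.
    If a cell map moved one of these boundary coordinates, then, by minimality,
    the image of [x] in every cell moved that way would be nontrivial, hence
    would lie in an overlapping cell that is closer to the faces containing
    [x].  Following these overlaps at all scales yields e-chains, for every e,
    from some [z <> x] in [E] to [x], a contradiction.  So cells of equal level
    differ only in coordinates where [x] is interior to the cube, and small
    clopen neighbourhoods of [x] have clopen images in every cell.

    Therefore, for some fixed word [u] of length m, a component that meets the
    subcell [wu] of a level-k cell [w] has size at most n^-k.  The points whose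
    component has size more than 1/l thus avoid one of the N^m subcells of each
    cell of large level, which bounds their dimension by
    log(N^m - 1) / (m log n), uniformly in l.  This is less than
    log N / log n = dim E. *)
Require Import Defs.
From mathcomp Require Import lra zify ring.

Set Implicit Arguments.
Unset Strict Implicit.
Unset Printing Implicit Defensive.

Local Open Scope classical_set_scope.
Local Open Scope ring_scope.

(** * Chain components *)

Section ChainComponents.
Variables (R : realType) (T : pseudoMetricType R).
Implicit Types (E U V : set T) (x y z : T) (e r : R).

(** Compactness in the form used below: the sets [F e] are a base of a proper filter containing [E],
    and [y] is a cluster point of it. *)
Lemma compact_decreasing_cluster E (F : R -> set T) : compact E ->
  (forall e, 0 < e -> F e !=set0) ->
  (forall e e', 0 < e -> e <= e' -> F e `<=` F e') ->
  (forall e, 0 < e -> F e `<=` E) ->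
  exists2 y, E y & forall e, 0 < e -> exists2 z, F e z & ball y e z.
Proof.
move=> cE F0 Fsub FE.
pose G := filter_from [set e : R | 0 < e] F.
have FG : Filter G.
  apply: filter_from_filter; first by exists 1 => /=.
  move=> e e' /= e0 e'0; have m0 : 0 < Num.min e e' by rewrite lt_min e0.
  by exists (Num.min e e') => // z Fz; split;
    apply: (Fsub _ _ m0 _ _ Fz); rewrite ge_min lexx ?orbT.
have PG : ProperFilter G by apply: filter_from_proper.
have GE : G E by exists 1 => /=; [exact: ltr01|exact: FE].
have [y [Ey cly]] := cE G PG GE.
exists y => // e e0.
have [z [Fz bz]] := cly (F e) (ball y e) (ex_intro2 _ _ e e0 (fun _ h => h))
  (nbhsx_ballx y e e0).
by exists z.
Qed.

Definition chain_closed E e U :=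
  forall u v, U u -> E v -> ball u e v -> U v.

(** The least [e]-closed set containing [x], that is, what finite [e]-chains from [x] reach; in this
    encoding, induction along a chain is the choice of a set [U]. *)
Definition chain_component E e x : set T :=
  [set y | forall U, U x -> chain_closed E e U -> U y].

Lemma chain_component_refl E e x : chain_component E e x x.
Proof. by []. Qed.

Lemma chain_component_closed E e x : chain_closed E e (chain_component E e x).
Proof. by move=> u v Ku Ev uv U Ux cU; apply: (cU _ _ _ Ev uv); exact: Ku. Qed.

Lemma chain_component_sub E e x : E x -> chain_component E e x `<=` E.
Proof. by move=> Ex y /(_ E Ex) h; apply: h => u v _. Qed.

Lemma chain_component_le E e e' x : e <= e' ->
  chain_component E e x `<=` chain_component E e' x.
Proof.
move=> ee' y Ky U Ux cU; apply: Ky => // u v Uu Ev uv; apply: cU Uu Ev _.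
exact: le_ball ee' _ uv.
Qed.

(** No point of [E] outside [U] is within [e] of [U], so [U] is relatively clopen in [E] and cannot
    split a connected [C]. *)
Lemma chain_closed_clopen E e U : 0 < e -> U `<=` E -> chain_closed E e U ->
  forall C, connected C -> C `<=` E -> C `&` U !=set0 -> C `<=` U.
Proof.
move=> e0 UE cU C Cc CE CU0.
suff -> : C = C `&` U by apply: subIsetr.
apply/esym/Cc => //.
- exists (\bigcup_(u in U) (ball u e)°).
    by apply: bigcup_open => u _; exact: open_interior.
  apply/seteqP; split=> z [Cz].
    move=> Uz; split=> //; exists z => //.
    by rewrite /interior; exact: nbhsx_ballx.
  move=> [u Uu /interior_subset uz]; split => //.
  exact: (cU _ _ Uu (CE _ Cz) uz).
- exists (~` \bigcup_(v in E `\` U) (ball v e)°).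
    apply: open_closedC; apply: bigcup_open => u _; exact: open_interior.
  apply/seteqP; split=> z [Cz].
    move=> Uz; split=> // -[v [Ev nUv] /interior_subset vz]; apply: nUv.
    exact: (cU _ _ Uz Ev (ball_sym vz)).
  move=> h; split => //; apply: contrapT => nUz; apply: h; exists z.
    by split => //; exact: CE.
  by rewrite /interior; exact: nbhsx_ballx.
Qed.

(** * Quasicomponents of a compact set *)

Section Quasicomponent.
Variables (E : set T) (x : T).
Hypotheses (cE : compact E) (Ex : E x).

(** In a compact [E] every relatively clopen set is closed under [e]-steps for some small [e], so
    this is the intersection of all relatively clopen sets containing [x]. *)
Definition quasicomponent := \bigcap_(e in [set e : R | 0 < e])
  chain_component E e x.
Local Notation Q := quasicomponent.

Lemma quasicomponent_sub : Q `<=` E.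
Proof. by move=> y /(_ 1 ltr01); exact: chain_component_sub. Qed.

Lemma quasicomponent_limit y : E y -> (forall e, 0 < e ->
  exists2 z, chain_component E e x z & ball y e z) -> Q y.
Proof.
move=> Ey h e /= e0; have [z Kz yz] := h e e0.
exact: chain_component_closed Kz Ey (ball_sym yz).
Qed.

(** Otherwise points of [A] ever closer to the rest of [Q] accumulate at some [y], which is in [A]
    because [A] is closed in [Q]; openness of [A] at [y] then captures points supposed to lie
    outside [A]. *)
Lemma quasicomponent_gap A : (exists2 C, open C & A = Q `&` C) ->
  (exists2 C, closed C & A = Q `&` C) ->
  exists2 e, 0 < e & forall a b, A a -> Q b -> ball a e b -> A b.
Proof.
move=> [V oV AV] [C cC AC]; apply: contrapT => h.
pose F e := [set a | A a /\ exists b, [/\ Q b, ~ A b & ball a e b]].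
have [|e e' e0 ee' a [Aa [b [Qb nAb ab]]]|e e0 a [+ _]|y Ey yF] :=
  @compact_decreasing_cluster E F cE.
- move=> e e0; apply: contrapT => F0; apply: h; exists e => // a b Aa Qb ab.
  by apply: contrapT => nAb; apply: F0; exists a; split => //; exists b.
- by split => //; exists b; split => //; exact: le_ball ab.
- by rewrite AC => -[/quasicomponent_sub].
have Qy : Q y.
  apply: quasicomponent_limit => // e e0; have [z [Az _] yz] := yF e e0.
  by exists z => //; move: Az; rewrite AC => -[/(_ _ e0)].
have Ay : A y.
  rewrite AC; split => //; apply: cC => B /nbhs_ballP[e /= e0 eB].
  have [z [Az _] yz] := yF e e0.
  by exists z; split; [move: Az; rewrite AC => -[]|exact: eB].
have : nbhs y V by apply: open_nbhs_nbhs; split => //; move: Ay; rewrite AV => -[].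
move=> /nbhs_ballP[e /= e0 eV].
have [|z [Az [b [Qb nAb zb]]] yz] := yF (e / 2); first by rewrite divr_gt0.
apply: nAb; rewrite AV; split => //; apply: eV.
by rewrite [e]splitr; exact: ball_triangle yz zb.
Qed.

(* Otherwise, for every small [e], the [e]-chain leading from the part of the
   quasicomponent that contains [x] to the other part has a vertex away from
   both; such vertices accumulate at a point of the quasicomponent. *)
Lemma quasicomponent_connected : connected Q.
Proof.
(* A clopen piece missing [x] is replaced by its complement in [Q]. *)
suff main A : A x -> (exists2 C, open C & A = Q `&` C) ->
    (exists2 C, closed C & A = Q `&` C) -> Q `<=` A.
  move=> B [b Bb] [V oV BV] [C cC BC].
  apply/seteqP; split; first by rewrite BV; exact: subIsetl.
  have [Bx|nBx] := pselect (B x); first by apply: main => //; [exists V|exists C].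
  have : Q `<=` Q `\` B.
    apply: main; first by split => // e _; exact: chain_component_refl.
      exists (~` C); first exact: closed_openC.
      by rewrite BC setDIr setDv set0U.
    exists (~` V); first exact: open_closedC.
    by rewrite BV setDIr setDv set0U.
  by move=> /(_ b) []; [move: Bb; rewrite BV => -[]|].
move=> Ax oA cA b Qb; apply: contrapT => nAb.
have [eta eta0 gap] := quasicomponent_gap oA cA.
have AQ : A `<=` Q by case: cA => C _ ->; exact: subIsetl.
have eta30 : 0 < eta / 3 by rewrite divr_gt0.
pose F e := [set z | chain_component E e x z /\
                     forall a, Q a -> ~ ball a (eta / 3) z].
have F0small e : 0 < e -> e <= eta / 3 -> F e !=set0.
  move=> e0 ee; apply: contrapT => Fe0.
  have near z : chain_component E e x z -> exists2 a, Q a & ball a (eta / 3) z.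
    move=> Kz; apply: contrapT => h; apply: Fe0; exists z; split => // a Qa az.
    by apply: h; exists a.
  (* If every vertex is near [Q], the vertices near [A] are closed under [e]-steps: the three steps
     from [a] to [u], [v] and [a'] together stay within the gap [eta]. So [b] is near [A], hence in
     [A]. *)
  have [] : [set z | chain_component E e x z /\
       exists2 a, A a & ball a (eta / 3) z] b.
    apply: (Qb e e0); first by split => //; exists x => //; exact: ballxx.
    move=> u v [Ku [a Aa au]] Ev uv.
    have Kv := chain_component_closed Ku Ev uv; split => //.
    have [a' Qa' a'v] := near v Kv; exists a' => //.
    apply: (gap a) => //.
    have -> : eta = eta / 3 + eta / 3 + eta / 3 by lra.
    apply: ball_triangle (ball_sym a'v); apply: ball_triangle au _.
    exact: le_ball uv.
  move=> _ [a Aa ab]; apply/nAb/(gap a) => //.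
  by apply: le_ball ab; lra.
have [e e0|e e' e0 ee' z [Kz nz]|e e0 z [Kz _]|y Ey yF] :=
  @compact_decreasing_cluster E F cE.
- have [z [Kz nz]] : F (Num.min e (eta / 3)) !=set0.
    by apply: F0small; rewrite ?lt_min ?e0// ge_min lexx orbT.
  exists z; split => //; apply: chain_component_le Kz.
  by rewrite ge_min lexx.
- by split => //; exact: chain_component_le Kz.
- exact: chain_component_sub Kz.
have Qy : Q y.
  apply: quasicomponent_limit => // e e0; have [z [Kz _] yz] := yF e e0.
  by exists z.
by have [z [_ /(_ y Qy)]] := yF _ eta30.
Qed.

(** If not, points of ever finer chain components outside the ball accumulate at a point of the
    quasicomponent. That set is connected and contains [x], so the limit is [x], and some of the
    points enter the ball. *)
Lemma trivial_chain_component r : 0 < r -> trivial_points E x ->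
  exists2 e, 0 < e & chain_component E e x `<=` ball x r.
Proof.
move=> r0 tx; apply: contrapT => h.
pose F e := chain_component E e x `\` ball x r.
have [e e0|e e' e0 ee' z [Kz nz]|e e0 z [Kz _]|y Ey yF] :=
  @compact_decreasing_cluster E F cE.
- apply: contrapT => F0; apply: h; exists e => // z Kz.
  by apply: contrapT => nz; apply: F0; exists z.
- by split => //; exact: chain_component_le Kz.
- exact: chain_component_sub Kz.
have Qy : Q y.
  apply: quasicomponent_limit => // e e0; have [z [Kz _] yz] := yF e e0.
  by exists z.
have : connected_component E x y.
  apply: (connected_component_max _ quasicomponent_sub
    quasicomponent_connected) => // e _; exact: chain_component_refl.
rewrite tx /= => yx.
by have [z [_ nz]] := yF r r0; rewrite yx.
Qed.

End Quasicomponent.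

Lemma seq_uniform_radius (I : eqType) (s : seq I) (P : I -> R -> Prop) :
  (forall i e e', e' <= e -> P i e -> P i e') ->
  (forall i, i \in s -> exists2 e, 0 < e & P i e) ->
  exists2 e, 0 < e & forall i, i \in s -> P i e.
Proof.
move=> Pmono; elim: s => [|i s IH] h; first by exists 1.
have [e e0 Pe] := h i (mem_head _ _).
have [|e' e'0 Pe'] := IH; first by move=> j js; apply: h; rewrite inE js orbT.
exists (Num.min e e') => [|j]; first by rewrite lt_min e0.
rewrite inE => /orP[/eqP ->|/Pe' Pj].
  by apply: Pmono Pe; rewrite ge_min lexx.
by apply: Pmono Pj; rewrite ge_min lexx orbT.
Qed.

End ChainComponents.

(** * Cells of a fractal cube *)

Lemma ball_rowP (R : realType) (d : nat) (x y : 'rV[R]_d) (e : R) : 0 < e ->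
  ball x e y <-> forall i, `|x ord0 i - y ord0 i| < e.
Proof.
move=> e0; split=> [[_ h] i|h]; first exact: h.
by split => // i j; rewrite (ord1 i); exact: h.
Qed.

Section Words.
Variables (R : realType) (d n : nat) (D : {set 'rV['I_n]_d}).
Implicit Types (w : seq 'rV['I_n]_d) (z : 'rV[R]_d).

Definition cell_map w z : 'rV[R]_d :=
  foldr (fun h z => n%:R^-1 *: (z + digit_vec R h)) z w.

(** Base-[n] numeral of the [i]-th digits, first letter most significant; divided by [n ^ size w] it
    is the lower corner of the cell of [w]. *)
Fixpoint code w (i : 'I_d) : nat :=
  if w is h :: w' then (h ord0 i * n ^ size w' + code w' i)%N else 0%N.

Fixpoint words k : seq (seq 'rV['I_n]_d) :=
  if k is k'.+1 then [seq h :: w | h <- enum D, w <- words k'] else [:: [::]].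

Lemma cell_map_cat w w' z : cell_map (w ++ w') z = cell_map w (cell_map w' z).
Proof. exact: foldr_cat. Qed.

Lemma code_lt w i : (code w i < n ^ size w)%N.
Proof.
elim: w => //= h w IH; rewrite expnS.
have := ltn_ord (h ord0 i); nia.
Qed.

Lemma code_inj w w' : size w = size w' -> code w =1 code w' -> w = w'.
Proof.
elim: w w' => [|h w IH] [|h' w'] //= [sw] cw.
have h_ww' i : (h ord0 i = h' ord0 i :> nat) /\ code w i = code w' i.
  have := cw i; have := code_lt w i; have := code_lt w' i; rewrite -sw.
  move: (n ^ size w)%N => P cw'P cwP e.
  have P0 : (0 < P)%N by exact: leq_ltn_trans cwP.
  have := congr1 (divn^~ P) e; rewrite /= !divnMDl// !divn_small// !addn0 => hh'.
  by split => //; move: e; rewrite hh' => /addnI.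
rewrite (IH _ sw) => [|i]; last by case: (h_ww' i).
congr (_ :: _); apply/rowP => i; apply/val_inj; by case: (h_ww' i).
Qed.

Lemma mem_words k w : (w \in words k) = (size w == k) && all (mem D) w.
Proof.
elim: k w => [|k IH] [|h w] //=.
  by apply/allpairsP => -[[? ?] [_ _]].
apply/allpairsP/idP => [[[h' w'] [/= h'D w'k [-> ->]]]|/and3P[sw hD wD]].
  by rewrite eqSS; move: w'k; rewrite IH => /andP[-> ->]; rewrite andbT -mem_enum.
by exists (h, w); split => //=; rewrite ?mem_enum// IH -eqSS sw.
Qed.

Lemma size_words k : size (words k) = (#|D| ^ k)%N.
Proof. by elim: k => //= k IH; rewrite size_allpairs IH -cardE expnS. Qed.

Lemma uniq_words k : uniq (words k).
Proof.
elim: k => //= k IH; apply: allpairs_uniq; rewrite ?enum_uniq// => -[h w] [h' w'].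
by move=> _ _ /= [-> ->].
Qed.

Lemma size_mem_words k w : w \in words k -> size w = k.
Proof. by rewrite mem_words => /andP[/eqP]. Qed.

Lemma cat_words k k' w w' : w \in words k -> w' \in words k' ->
  w ++ w' \in words (k + k').
Proof.
rewrite !mem_words => /andP[/eqP sw wD] /andP[/eqP sw' w'D].
by rewrite size_cat sw sw' eqxx all_cat wD.
Qed.

Hypothesis hn : (1 < n)%N.

Lemma scale_gt0 k : 0 < n%:R ^+ k :> R.
Proof. by rewrite exprn_gt0// ltr0n; lia. Qed.

Lemma scale_small (e : R) : 0 < e ->
  exists k0, forall k, (k0 <= k)%N -> (n%:R ^+ k)^-1 < e.
Proof.
move=> e0; exists (Num.bound e^-1) => k k0k.
rewrite invf_plt ?posrE ?scale_gt0//.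
apply: lt_trans (archi_boundP _) _; first by rewrite invr_ge0 ltW.
by rewrite -natrX ltr_nat (leq_ltn_trans k0k)// ltn_expl.
Qed.

Lemma cell_mapE w z i :
  cell_map w z ord0 i = (z ord0 i + (code w i)%:R) / n%:R ^+ size w.
Proof.
elim: w => [|h w IH] /=; first by rewrite addr0 expr0 divr1.
rewrite !mxE {}IH exprS natrD natrM natrX.
have := scale_gt0 (size w); have : 0 < n%:R :> R by rewrite ltr0n; lia.
move: (n%:R ^+ _) => s; move: (n%:R) => m m0 s0; field.
by rewrite !gt_eqF.
Qed.

Variable E : set 'rV[R]_d.
Hypothesis hE : fractal_cube D E.

Let cE : compact E. Proof. by case: hE. Qed.

Lemma cell_sub w z : all (mem D) w -> E z -> E (cell_map w z).
Proof.
move=> wD Ez; elim: w wD => //= h w IH /andP[hD /IH Ew].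
by case: hE => _ _ ->; exists h => //; exists (cell_map w z).
Qed.

Lemma words_cell_sub k w z : w \in words k -> E z -> E (cell_map w z).
Proof. by rewrite mem_words => /andP[_]; exact: cell_sub. Qed.

Lemma cells_cover k z : E z ->
  exists2 w, w \in words k & exists2 z', E z' & z = cell_map w z'.
Proof.
elim: k z => [|k IH] z Ez; first by exists [::] => //; exists z.
have [h hD [y Ey zy]] : (\bigcup_(h in [set` D])
    [set n%:R^-1 *: (z + digit_vec R h) | z in E]) z.
  by case: hE => _ _ <-.
have [w wk [z' Ez' yw]] := IH y Ey.
exists (h :: w); last by exists z' => //=; rewrite -yw -zy.
by move: wk; rewrite !mem_words /= eqSS => /andP[-> ->]; rewrite andbT.
Qed.

(** In a cell of level [k0] the coordinate is [(y + c) / n^k0] with [0 <= c <= n^k0 - 1] and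
    [|y| <= B]; the excess over the unit interval is at most [B / n^k0]. *)
Lemma fractal_cube_itv z i : E z -> 0 <= z ord0 i <= 1.
Proof.
have [B B0 EB] : exists2 B : R, 0 < B & forall z i, E z -> `|z ord0 i| <= B.
  have [B [_ EB]] := compact_bounded cE.
  exists (`|B| + 1); first by rewrite ltr_wpDl.
  move=> y j Ey; have := EB (`|B| + 1); rewrite ltr_pwDr ?ler_norm//.
  move=> /(_ isT y Ey) /=; apply: le_trans.
  rewrite [leRHS]mx_normrE.
  exact: (le_bigmax _ (fun ij : 'I_1 * 'I_d => `|y ij.1 ij.2|) (ord0, j)).
move=> Ez.
have close (e : R) : 0 < e -> - e < z ord0 i < 1 + e.
  move=> e0; have [|k0 /(_ k0 (leqnn _)) ks] := @scale_small (e / B).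
    by rewrite divr_gt0.
  have [w wk [y Ey ->]] := cells_cover k0 Ez.
  rewrite cell_mapE (size_mem_words wk); move: ks.
  have := code_lt w i; rewrite (size_mem_words wk).
  rewrite -(ler_nat R) natrX -natr1; have := EB y i Ey.
  rewrite ler_norml => /andP[yB1 yB2].
  have := scale_gt0 k0; move: (n%:R ^+ k0) => s s0 cs.
  rewrite ltr_pdivlMr// => ks.
  have eB : B < e * s by rewrite -ltr_pdivrMr// mulrC.
  rewrite ltr_pdivlMr// ltr_pdivrMr//.
  have c0 : 0 <= (code w i)%:R :> R by [].
  by apply/andP; split; nra.
apply/andP; split.
  apply/ler_addgt0Pr => e e0; have /andP[] := close e e0; lra.
apply/ler_addgt0Pr => e e0; have /andP[] := close e e0; lra.
Qed.

Lemma cell_diam k w z z' i : w \in words k -> E z -> E z' ->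
  `|cell_map w z ord0 i - cell_map w z' ord0 i| <= (n%:R ^+ k)^-1.
Proof.
move=> /size_mem_words sw /fractal_cube_itv-/(_ i)/andP[z0 z1].
move=> /fractal_cube_itv-/(_ i)/andP[z'0 z'1].
rewrite !cell_mapE sw -mulrBl normrM (gtr0_norm (_ : 0 < _^-1)) ?invr_gt0 ?scale_gt0//.
apply: ler_piMl; first by rewrite invr_ge0 ltW ?scale_gt0.
by rewrite ler_norml; apply/andP; split; lra.
Qed.

Lemma ball_cell_map k w a z e : 0 < e -> w \in words k ->
  ball (cell_map w a) (e / n%:R ^+ k) (cell_map w z) -> ball a e z.
Proof.
move=> e0 /size_mem_words sw.
move=> /ball_rowP h; apply/ball_rowP => // i.
have := h (divr_gt0 e0 (scale_gt0 k)) i.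
rewrite !cell_mapE sw -mulrBl normrM (gtr0_norm (_ : 0 < _^-1)) ?invr_gt0 ?scale_gt0//.
rewrite ltr_pM2r ?invr_gt0 ?scale_gt0//.
by have -> : a ord0 i + (code w i)%:R - (z ord0 i + (code w i)%:R) =
  a ord0 i - z ord0 i by ring.
Qed.

Lemma cell_overlap k w w' x z i : w \in words k -> w' \in words k ->
  cell_map w x = cell_map w' z ->
  x ord0 i + (code w i)%:R = z ord0 i + (code w' i)%:R.
Proof.
move=> /size_mem_words sw /size_mem_words sw' /(congr1 (fun y : 'rV[R]_d => y ord0 i)).
rewrite !cell_mapE sw sw'; apply: mulIf.
by rewrite invr_eq0 gt_eqF ?scale_gt0.
Qed.

(** A jump shorter than [rho] cannot leave for another cell, and a jump inside the cell rescales to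
    one of length less than [e] in [E]. *)
Lemma cell_chain_closed k w U e rho : w \in words k ->
  0 < e -> 0 < rho -> chain_closed E e U ->
  (forall u w' z, U u -> w' \in words k -> w' != w -> E z ->
     ~ ball (cell_map w u) rho (cell_map w' z)) ->
  chain_closed E (Num.min rho (e / n%:R ^+ k)) (cell_map w @` U).
Proof.
move=> wk e0 rho0 cU sep _ v [u Uu <-] Ev uv.
have [w' w'k [z Ez zv]] := cells_cover k Ev.
rewrite zv in uv *.
have [w'w|w'w] := eqVneq w' w; last first.
  by case: (sep u w' z) => //; apply: le_ball uv; rewrite ge_min lexx.
rewrite w'w in uv *; exists z => //; apply: (cU u) => //.
apply: (@ball_cell_map k w) => //; apply: le_ball uv.
by rewrite ge_min lexx orbT.
Qed.

(** The image of [U] is relatively clopen in [E] by [cell_chain_closed], so it contains every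
    component that it meets. *)
Lemma component_cell k w U e rho u : w \in words k ->
  0 < e -> 0 < rho -> U `<=` E -> U u -> chain_closed E e U ->
  (forall u w' z, U u -> w' \in words k -> w' != w -> E z ->
     ~ ball (cell_map w u) rho (cell_map w' z)) ->
  connected_component E (cell_map w u) `<=` cell_map w @` U.
Proof.
move=> wk e0 rho0 UE Uu cU sep.
have := cell_chain_closed wk e0 rho0 cU sep.
move=> /chain_closed_clopen; apply.
- by rewrite lt_min rho0 divr_gt0// scale_gt0.
- by move=> _ [y Uy <-]; apply: (words_cell_sub wk); exact: UE.
- exact: component_connected.
- exact: connected_component_sub.
exists (cell_map w u); split; last by exists u.
by apply: connected_component_refl; apply: (words_cell_sub wk); exact: UE.
Qed.

Lemma trivial_points_sub : trivial_points E `<=` E.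
Proof.
move=> x tx; apply: (@connected_component_sub _ _ x); by rewrite tx.
Qed.

(** Otherwise preimages of ever better approximations accumulate at some [y] in [E], and
    [cell_map w' y] is the point itself. *)
Lemma cell_separation k w w' x : E x -> w' \in words k ->
  (forall z, E z -> cell_map w x <> cell_map w' z) ->
  exists2 rho, 0 < rho & forall z, E z -> ~ ball (cell_map w x) rho (cell_map w' z).
Proof.
move=> Ex w'k sep; apply: contrapT => h.
pose F e := [set z | E z /\ ball (cell_map w x) e (cell_map w' z)].
have [e e0|e e' e0 ee' z [Ez bz]|e e0 z []//|y Ey yF] :=
  @compact_decreasing_cluster _ _ E F cE.
- apply: contrapT => F0; apply: h; exists e => // z Ez bz.
  by apply: F0; exists z.
- by split => //; exact: le_ball bz.
apply: (sep y Ey); apply/rowP => i; apply/eqP; rewrite -subr_eq0 -normr_le0.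
apply/ler_addgt0Pr => e e0; rewrite add0r.
have e20 : 0 < e / 2 by rewrite divr_gt0.
have [z [Ez bz] yz] := yF _ e20.
move: bz => /(ball_rowP _ _ e20)/(_ i); move: yz => /(ball_rowP _ _ e20)/(_ i).
rewrite !(cell_mapE w'); move: (cell_map w x ord0 i) => a.
have := scale_gt0 (size w'); have : 1 <= n%:R ^+ size w' :> R.
  by rewrite exprn_ege1// ler1n; lia.
move: (n%:R ^+ _) => s s1 s0; move: (y ord0 i) (z ord0 i) (code w' i)%:R => p q c.
have -> : (p + c) / s = (q + c) / s + (p - q) / s by field; rewrite gt_eqF.
move: ((q + c) / s) => b pq ab.
have : `|(p - q) / s| <= `|p - q|.
  by rewrite normrM (gtr0_norm (_ : 0 < s^-1)) ?invr_gt0// ler_piMr// invf_le1.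
move=> h1; rewrite opprD addrA; apply: le_trans (ler_normB _ _) _.
lra.
Qed.

(* A cell containing a trivial point that no other cell of the same level
   meets carries arbitrarily small clopen neighbourhoods of it. *)
Lemma trivial_cell_map k w x : w \in words k -> trivial_points E x ->
  (forall w' z, w' \in words k -> w' != w -> E z ->
     cell_map w x <> cell_map w' z) ->
  trivial_points E (cell_map w x).
Proof.
move=> wk tx sep; have Ex := trivial_points_sub tx.
have [rho rho0 sep'] : exists2 rho, 0 < rho & forall w', w' \in words k ->
    w' != w -> forall z, E z -> ~ ball (cell_map w x) rho (cell_map w' z).
  apply: (@seq_uniform_radius R _ (words k) (fun w' rho => w' != w ->
    forall z, E z -> ~ ball (cell_map w x) rho (cell_map w' z))).
    by move=> w' e e' ee' h w'w z Ez bz; apply: (h w'w z Ez); exact: le_ball bz.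
  move=> w' w'k; have [->|w'w] := eqVneq w' w; first by exists 1.
  have [z Ez|rho rho0 h] := @cell_separation k w w' x Ex w'k; first exact: sep.
  by exists rho.
apply/seteqP; split; last first.
  by move=> _ ->; apply: connected_component_refl; exact: words_cell_sub wk Ex.
move=> q Cq.
suff small r : 0 < r -> r <= rho / 2 -> ball (cell_map w x) r q.
  apply/rowP => i; apply/eqP; rewrite -subr_eq0 -normr_le0.
  apply/ler_addgt0Pr => e e0; rewrite add0r distrC.
  have m0 : 0 < Num.min e (rho / 2) by rewrite lt_min e0 divr_gt0.
  have /(ball_rowP _ _ m0)/(_ i) : ball (cell_map w x) (Num.min e (rho / 2)) q.
    by apply: small => //; rewrite ge_min lexx orbT.
  by rewrite lt_min => /andP[/ltW].
move=> r0 rrho.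
have [e e0 Kr] := trivial_chain_component cE Ex r0 tx.
have contr u : chain_component E e x u -> ball (cell_map w x) r (cell_map w u).
  move=> /Kr /(ball_rowP _ _ r0) xu; apply/ball_rowP => // i.
  apply: le_lt_trans (xu i); rewrite !cell_mapE -mulrBl normrM.
  rewrite (gtr0_norm (_ : 0 < _^-1)) ?invr_gt0 ?scale_gt0//.
  have -> : x ord0 i + (code w i)%:R - (u ord0 i + (code w i)%:R) =
    x ord0 i - u ord0 i by ring.
  rewrite ler_piMr// invf_le1 ?scale_gt0//.
  by rewrite exprn_ege1// ler1n; lia.
have rho20 : 0 < rho / 2 by rewrite divr_gt0.
have := @component_cell k w (chain_component E e x) e (rho / 2) x wk e0 rho20
  (chain_component_sub Ex) (@chain_component_refl _ _ E e x)
  (@chain_component_closed _ _ E e x).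
move=> /(_ _ q Cq)[|u Ku <-]; last exact: contr.
move=> u w' z Ku w'k w'w Ez bz; apply: (sep' w' w'k w'w z Ez).
(* Half of [rho] pays for moving from [cell_map w x] to [cell_map w u]. *)
rewrite [rho]splitr; apply: ball_triangle bz.
by apply: le_ball (contr u Ku).
Qed.

End Words.

(** * Trivial points away from the boundary of the cube *)

Lemma natr_dist_lt1 (R : realType) (a b : nat) :
  `|a%:R - b%:R : R| < 1 -> a = b.
Proof.
rewrite ltr_norml => /andP[h1 h2]; apply/eqP; rewrite eqn_leq.
by apply/andP; split; rewrite -ltnS -(ltr_nat R) -natr1; lra.
Qed.

Section Boundary.
Variables (R : realType) (d n : nat) (D : {set 'rV['I_n]_d}).
Hypothesis hn : (1 < n)%N.
Variable E : set 'rV[R]_d.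
Hypothesis hE : fractal_cube D E.
Implicit Types (w : seq 'rV['I_n]_d) (x z : 'rV[R]_d).

Let cE : compact E. Proof. by case: hE. Qed.

Definition boundary_coords x : {pred 'I_d} :=
  [pred i | (x ord0 i == 0) || (x ord0 i == 1)].

(** The value [(x + c) / n^k] with [0 <= c <= n^k - 1] is [0] only if [x = c = 0], and [1] only if
    [x = 1]. *)
Lemma boundary_coords_cell k w x i : w \in words D k -> E x ->
  i \in boundary_coords (cell_map w x) -> cell_map w x ord0 i = x ord0 i.
Proof.
move=> wk Ex; have /andP[x0 x1] := fractal_cube_itv hn hE i Ex.
rewrite inE cell_mapE//; have := code_lt w i; have := scale_gt0 R hn (size w).
rewrite -(ler_nat R) natrX -natr1; move: (n%:R ^+ _) => s s0 cs.
have c0 : 0 <= (code w i)%:R :> R by [].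
move=> /orP[/eqP|/eqP] e; rewrite e; move: e.
  move=> /(congr1 (fun y => y * s)); rewrite divfK ?gt_eqF//; lra.
move=> /(congr1 (fun y => y * s)); rewrite divfK ?gt_eqF//; lra.
Qed.

Lemma min_boundary_trivial : trivial_points E !=set0 ->
  exists2 x, trivial_points E x & forall y, trivial_points E y ->
    (#|boundary_coords x| <= #|boundary_coords y|)%N.
Proof.
move=> [x0 tx0].
pose P k := `[< exists2 y, trivial_points E y & #|boundary_coords y| = k >].
have exP : exists k, P k by exists #|boundary_coords x0|; apply/asboolP; exists x0.
case: (ex_minnP exP) => k /asboolP[x tx <-] min_x; exists x => // y ty.
by apply: min_x; apply/asboolP; exists y.
Qed.

Section MinimalBoundary.
Variable x : 'rV[R]_d.
Hypothesis tx : trivial_points E x.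
Hypothesis min_x : forall y, trivial_points E y ->
  (#|boundary_coords x| <= #|boundary_coords y|)%N.

Let Ex : E x. Proof. exact: trivial_points_sub tx. Qed.

(* Otherwise the image of [x] in that cell is a trivial point with fewer
   boundary coordinates. *)
Lemma moved_cell_overlap k w i : w \in words D k -> i \in boundary_coords x ->
  cell_map w x ord0 i <> x ord0 i ->
  exists w' z, [/\ w' \in words D k, w' != w, E z & cell_map w x = cell_map w' z].
Proof.
move=> wk bi wi; apply: contrapT => h.
have ty : trivial_points E (cell_map w x).
  apply: (trivial_cell_map hn hE wk tx) => w' z w'k w'w Ez e.
  by apply: h; exists w', z.
have := min_x ty; rewrite leqNgt => /negP; apply.
apply: proper_card; apply/properP; split.
  apply/fintype.subsetP => j bj; move: (bj); rewrite inE.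
  by rewrite (boundary_coords_cell wk Ex bj) [j \in _]inE.
by exists i => //; apply/negP => /(boundary_coords_cell wk Ex).
Qed.

(** The two codes differ by [z_i - x_i], which is less than [1] in absolute value when
    [0 < x_i < 1]. *)
Lemma overlap_code k w w' z i : w \in words D k -> w' \in words D k -> E z ->
  cell_map w x = cell_map w' z -> i \notin boundary_coords x ->
  code w i = code w' i.
Proof.
move=> wk w'k Ez e; rewrite inE negb_or => /andP[x0 x1].
have := cell_overlap hn i wk w'k e.
have /andP[z0 z1] := fractal_cube_itv hn hE i Ez.
have /andP[] := fractal_cube_itv hn hE i Ex.
rewrite 2!le_eqVlt (negbTE x1) eq_sym (negbTE x0) /= => x0' x1' xz.
by apply: (@natr_dist_lt1 R); rewrite ltr_norml; apply/andP; split; lra.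
Qed.

(* The moves from [w] to an overlapping cell [w'] push every boundary
   coordinate towards that of [x]; [potential] bounds the steps left. *)
Definition potential k w := (\sum_(i < d)
  (if x ord0 i == 0%R then code w i else n ^ k - code w i))%N.

(** From [x_i + c = z_i + c'], the code weakly drops where [x_i = 0], weakly grows where [x_i = 1]
    and is constant elsewhere; distinct words differ in some code. *)
Lemma potential_overlap k w w' z : w \in words D k -> w' \in words D k ->
  w' != w -> E z -> cell_map w x = cell_map w' z ->
  (potential k w' < potential k w)%N.
Proof.
move=> wk w'k w'w Ez e.
have le i : ((if x ord0 i == 0%R then code w' i else n ^ k - code w' i) <=
             (if x ord0 i == 0%R then code w i else n ^ k - code w i) ?= iff
             (code w i == code w' i))%N.
  have xz := cell_overlap hn i wk w'k e.
  have /andP[z0 z1] := fractal_cube_itv hn hE i Ez.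
  have := code_lt w i; have := code_lt w' i.
  rewrite (size_mem_words wk) (size_mem_words w'k).
  have [bi|bi] := boolP (i \in boundary_coords x); last first.
    rewrite (overlap_code wk w'k Ez e bi) => _ _.
    by split; rewrite ?leqnn ?eqxx.
  move: bi; rewrite inE; case: eqP => [xi _|_ /= /eqP xi] c c'.
    have : (code w' i <= code w i)%N by rewrite -(ler_nat R); lra.
    by move=> ?; split; lia.
  have : (code w i <= code w' i)%N by rewrite -(ler_nat R); lra.
  by move=> ?; split; lia.
rewrite ltn_neqAle !(leqif_sum (fun i _ => le i)) andbT; apply/negP => /fintype.forallP ww'.
move/eqP: w'w; apply; apply/esym/code_inj.
  by rewrite (size_mem_words wk) (size_mem_words w'k).
by move=> i; apply/eqP; have := ww' i.
Qed.

(** Induction on the potential. If [w] moves a boundary coordinate, the overlapping cell [w']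
    contains both images of [x], so they are less than [e] apart, and [w'] agrees with [w] in
    interior coordinates. *)
Lemma chain_to_min_boundary k e w : (n%:R ^+ k)^-1 < e -> w \in words D k ->
  (forall i, i \notin boundary_coords x ->
     `|cell_map w x ord0 i - x ord0 i| <= (n%:R ^+ k)^-1) ->
  chain_component E e x (cell_map w x).
Proof.
move=> ke; have s0 := scale_gt0 R hn k.
have e0 : 0 < e by apply: lt_trans ke; rewrite invr_gt0.
have [N] := ubnP (potential k w); elim: N w => // N IH w; rewrite ltnS => wN wk near.
have [fix_w|] := pselect (forall i, i \in boundary_coords x ->
    cell_map w x ord0 i = x ord0 i).
  apply: (chain_component_closed (@chain_component_refl _ _ E e x)).
    exact: (words_cell_sub hE wk Ex).
  apply/ball_rowP => // i; rewrite distrC; apply: le_lt_trans ke.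
  have [bi|bi] := boolP (i \in boundary_coords x); last exact: near.
  by rewrite fix_w// subrr normr0 invr_ge0 ltW.
move=> /existsNP[i /not_implyP[bi wi]].
have [w' [z [w'k w'w Ez ww']]] := moved_cell_overlap wk bi wi.
have w'x_w : ball (cell_map w' x) e (cell_map w x).
  rewrite ww'; apply/ball_rowP => // j.
  exact: le_lt_trans (cell_diam hn hE j w'k Ex Ez) ke.
apply: chain_component_closed w'x_w; last exact: (words_cell_sub hE wk Ex).
apply: IH => //; first exact: leq_trans (potential_overlap wk w'k w'w Ez ww') wN.
move=> j bj; suff -> : cell_map w' x ord0 j = cell_map w x ord0 j by exact: near.
rewrite !cell_mapE// (overlap_code wk w'k Ez ww' bj).
by rewrite (size_mem_words wk) (size_mem_words w'k).
Qed.

(** Overlap yields [z <> x] in [E] with the same interior coordinates as [x]. A small cell [v]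
    containing [z] has [cell_map v x] near [z], and an [e]-chain joins that image to [x]; so [z] is
    in every chain component of [x]. *)
Lemma min_boundary_fixed k w i : w \in words D k -> i \in boundary_coords x ->
  cell_map w x ord0 i = x ord0 i.
Proof.
move=> wk bi; apply: contrapT => wi.
have [w' [z [w'k w'w Ez ww']]] := moved_cell_overlap wk bi wi.
have xz j : j \notin boundary_coords x -> x ord0 j = z ord0 j.
  move=> bj; have := cell_overlap hn j wk w'k ww'.
  by rewrite (overlap_code wk w'k Ez ww' bj) => /addIr.
have [j /eqP xzj] : exists j, x ord0 j <> z ord0 j.
  apply/existsNP => zx; move/eqP: w'w; apply; apply/esym/code_inj.
    by rewrite (size_mem_words wk) (size_mem_words w'k).
  move=> j; have := cell_overlap hn j wk w'k ww'.
  by rewrite zx => /addrI /eqP; rewrite eqr_nat => /eqP.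
have r0 : 0 < `|x ord0 j - z ord0 j| by rewrite normr_gt0 subr_eq0.
have [e e0 Kr] := trivial_chain_component cE Ex r0 tx.
suff /Kr /(ball_rowP _ _ r0)/(_ j) : chain_component E e x z by rewrite ltxx.
have [k' /(_ k' (leqnn _)) k'e] := scale_small hn e0.
have [v vk' [z' Ez' zv]] := cells_cover hE k' Ez.
have vx_z l : `|cell_map v x ord0 l - z ord0 l| <= (n%:R ^+ k')^-1.
  by rewrite zv; exact: (cell_diam hn hE l vk' Ex Ez').
have Kv : chain_component E e x (cell_map v x).
  by apply: (chain_to_min_boundary k'e) => // l bl; rewrite (xz l bl).
apply: (chain_component_closed Kv Ez); apply/ball_rowP => // l.
exact: le_lt_trans (vx_z l) k'e.
Qed.

End MinimalBoundary.

(** [u] addresses a cell around [x] so small that it lies in a chain component of [x] inside the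
    ball of radius [r]. The image of that component in any cell [w] is relatively clopen, so it
    confines the components meeting [w ++ u]. *)
Lemma removable_word : trivial_points E !=set0 ->
  exists m, exists2 u, u \in words D m & forall k w z q i, w \in words D k ->
    E z -> connected_component E (cell_map (w ++ u) z) q ->
    `|cell_map (w ++ u) z ord0 i - q ord0 i| <= (n%:R ^+ k)^-1.
Proof.
move=> /min_boundary_trivial[x tx min_x].
have Ex := trivial_points_sub tx.
(* Points within [r] of [x] keep a margin [r] from the faces in interior coordinates, hence
   [r / n^k] inside a level-[k] cell. *)
have [r r0 xr] : exists2 r, 0 < r & forall i, i \in enum 'I_d ->
    i \notin boundary_coords x -> 2 * r <= x ord0 i <= 1 - 2 * r.
  apply: (@seq_uniform_radius R _ _ (fun i r => i \notin boundary_coords x ->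
    2 * r <= x ord0 i <= 1 - 2 * r)).
    by move=> i e e' ee' h /h /andP[? ?]; apply/andP; split; lra.
  move=> i _; have [bi|] := boolP (i \in boundary_coords x); first by exists 1.
  rewrite inE negb_or => /andP[x0 x1].
  have /andP[] := fractal_cube_itv hn hE i Ex.
  rewrite 2!le_eqVlt (negbTE x1) eq_sym (negbTE x0) /= => x0' x1'.
  exists (Num.min (x ord0 i) (1 - x ord0 i) / 2).
    by rewrite divr_gt0// lt_min x0' subr_gt0.
  move=> _; rewrite mulrC divfK// ge_min lexx /=.
  by rewrite lerBrDr addrC -lerBrDr ge_min lexx orbT.
have [e e0 Kr] := trivial_chain_component cE Ex r0 tx.
have [m /(_ m (leqnn _)) me] := scale_small hn e0.
have [u um [x' Ex' xu]] := cells_cover hE m Ex.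
exists m; exists u => // k w z q i wk Ez.
have uK y : E y -> chain_component E e x (cell_map u y).
  move=> Ey; apply: (chain_component_closed (@chain_component_refl _ _ E e x)).
    exact: (words_cell_sub hE um Ey).
  apply/ball_rowP => // j; apply: le_lt_trans me.
  rewrite {1}xu; exact: (cell_diam hn hE j um).
have s0 := scale_gt0 R hn k.
have rk0 : 0 < r / n%:R ^+ k by rewrite divr_gt0.
rewrite cell_map_cat.
have := @component_cell R d n D hn E hE k w (chain_component E e x) e
  (r / n%:R ^+ k) (cell_map u z) wk e0 rk0 (chain_component_sub Ex) (uK z Ez)
  (@chain_component_closed _ _ E e x).
move=> /(_ _ q) h /h[|v Kv <-]; last first.
  apply: (cell_diam hn hE i wk); first exact: (words_cell_sub hE um Ez).
  exact: chain_component_sub Kv.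
move=> v w' y Kv w'k w'w Ey.
have [j cj] : exists j, code w j <> code w' j.
  apply/existsNP => ww'; move/eqP: w'w; apply; apply/esym/code_inj => //.
  by rewrite (size_mem_words wk) (size_mem_words w'k).
(* Both cells fix the boundary coordinates of [x], so their codes agree there. *)
have bj : j \notin boundary_coords x.
  apply/negP => bj; apply: cj; apply/eqP; rewrite -(eqr_nat R); apply/eqP.
  have : cell_map w x ord0 j = cell_map w' x ord0 j.
    by rewrite (min_boundary_fixed tx min_x wk bj) (min_boundary_fixed tx min_x w'k bj).
  rewrite !cell_mapE// (size_mem_words wk) (size_mem_words w'k).
  by move=> /(congr1 (fun y => y * n%:R ^+ k)); rewrite !divfK ?gt_eqF// => /addrI.
have /andP[xj0 xj1] := xr j (mem_enum _ _) bj.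
have /(ball_rowP _ _ r0)/(_ j) := Kr _ Kv; rewrite ltr_norml => /andP[xv1 xv2].
have /andP[y0 y1] := fractal_cube_itv hn hE j Ey.
move=> /(ball_rowP _ _ rk0)/(_ j); rewrite !cell_mapE//.
rewrite (size_mem_words wk) (size_mem_words w'k) -mulrBl normrM.
rewrite (gtr0_norm (_ : 0 < _^-1)) ?invr_gt0// ltr_pM2r ?invr_gt0//.
rewrite ltr_norml => /andP[h1 h2].
by apply: cj; apply: (@natr_dist_lt1 R); rewrite ltr_norml; apply/andP; split; lra.
Qed.

End Boundary.

(** * Hausdorff null sets *)

Section Hausdorff.
Variables (R : realType) (d : nat).
Implicit Types (x y : 'rV[R]_d) (U A : set 'rV[R]_d) (s c : R).

Lemma coord_le_eucl_dist x y i : `|x ord0 i - y ord0 i| <= eucl_dist x y.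
Proof.
rewrite -sqrtr_sqr ler_sqrt; last by apply: sumr_ge0 => j _; exact: sqr_ge0.
rewrite (bigD1 i)//= lerDl; apply: sumr_ge0 => j _; exact: sqr_ge0.
Qed.

Lemma eucl_dist_le x y c : 0 <= c ->
  (forall i, `|x ord0 i - y ord0 i| <= c) -> eucl_dist x y <= Num.sqrt d%:R * c.
Proof.
move=> c0 h; rewrite -[in leRHS](ger0_norm c0) -sqrtr_sqr -sqrtrM// ler_sqrt.
  apply: le_trans (ler_sum _ (_ : forall i, true -> _ <= c ^+ 2)) _.
    by move=> i _; rewrite -real_normK ?num_real// ler_sqr ?nnegrE.
  by rewrite sumr_const card_ord mulr_natl.
by rewrite mulr_ge0 ?sqr_ge0.
Qed.

Lemma diam_set0 : diam (set0 : set 'rV[R]_d) = -oo%E.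
Proof.
rewrite /diam (_ : [set _ | _ in _] = set0) ?ereal_sup0//.
by apply/seteqP; split => // _ [p [[]]].
Qed.

Lemma diam_le U c :
  (forall x y, U x -> U y -> eucl_dist x y <= c) -> (diam U <= c%:E)%E.
Proof.
by move=> h; apply: ge_ereal_sup => _ [[x y] [/= Ux Uy] <-]; rewrite lee_fin h.
Qed.

Lemma eucl_dist_le_diam U x y : U x -> U y -> ((eucl_dist x y)%:E <= diam U)%E.
Proof. by move=> Ux Uy; apply: ereal_sup_ubound; exists (x, y). Qed.

Lemma diam_ge0 U : U !=set0 -> (0 <= diam U)%E.
Proof.
move=> [x Ux]; apply: le_trans (eucl_dist_le_diam Ux Ux).
by rewrite lee_fin sqrtr_ge0.
Qed.

Lemma hausdorff_weight_ge0 s U : (0 <= hausdorff_weight s U)%E.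
Proof. by rewrite /hausdorff_weight; case: ifP => // _; exact: poweR_ge0. Qed.

Lemma hausdorff_weight_le s U c : 0 <= s -> 0 <= c -> (diam U <= c%:E)%E ->
  (hausdorff_weight s U <= (c `^ s)%:E)%E.
Proof.
move=> s0 c0 Uc; rewrite /hausdorff_weight; case: ifPn => [_|/set0P U0].
  by rewrite lee_fin powR_ge0.
rewrite -poweR_EFin; apply: gt0_ler_poweR => //; rewrite in_itv /= leey andbT.
  exact: diam_ge0.
by rewrite lee_fin.
Qed.

Lemma hausdorff_premeasure_ge0 s delta A : (0 <= hausdorff_premeasure s delta A)%E.
Proof.
apply: le_ereal_inf_tmp => _ [U _ <-].
by apply: nneseries_ge0 => i _ _; exact: hausdorff_weight_ge0.
Qed.

Lemma hausdorff_nullP s A : hausdorff_measure s A = 0%E <->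
  forall delta eps : R, 0 < delta -> 0 < eps -> exists U : nat -> set 'rV[R]_d,
    [/\ A `<=` \bigcup_i U i, forall i, (diam (U i) <= delta%:E)%E &
        (\sum_(0 <= i <oo) hausdorff_weight s (U i) < eps%:E)%E].
Proof.
split=> [A0 delta eps delta0 eps0|h].
  have : (hausdorff_premeasure s delta A < eps%:E)%E.
    apply: le_lt_trans (_ : (_ <= 0)%E) _; last by rewrite lte_fin.
    by rewrite -A0; apply: ereal_sup_ubound; exists delta.
  by move=> /ereal_inf_lt[_ [U [AU Ud] <-] Ue]; exists U.
apply/eqP; rewrite eq_le; apply/andP; split; last first.
  apply: le_ereal_sup_tmp; exists (hausdorff_premeasure s 1 A).
    by exists 1 => //=.
  exact: hausdorff_premeasure_ge0.
apply: ge_ereal_sup => _ [delta /= delta0 <-].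
apply/lee_addgt0Pr => eps eps0; rewrite add0e.
have [U [AU Ud /ltW]] := h delta eps delta0 eps0; apply: le_trans.
by apply: ereal_inf_lbound; exists U.
Qed.

Lemma hausdorff_null_finite_cover s A :
  (forall delta eps : R, 0 < delta -> 0 < eps ->
    exists Us : seq (set 'rV[R]_d),
    [/\ forall x, A x -> exists2 U, U \in Us & U x,
        forall U, U \in Us -> (diam U <= delta%:E)%E &
        (\sum_(U <- Us) hausdorff_weight s U < eps%:E)%E]) ->
  hausdorff_measure s A = 0%E.
Proof.
move=> h; apply/hausdorff_nullP => delta eps delta0 eps0.
have [Us [AU Ud Ue]] := h delta eps delta0 eps0.
(* The padding by [set0] has diameter [-oo] and weight [0]. *)
exists (nth set0 Us); split.
- move=> x /AU[U UUs Ux]; exists (index U Us) => //.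
  by rewrite nth_index.
- move=> i; have [iU|iU] := ltnP i (size Us); first by apply: Ud; exact: mem_nth.
  by rewrite nth_default// diam_set0 leNye.
rewrite (nneseries_split 0 (size Us)); last by move=> *; exact: hausdorff_weight_ge0.
rewrite add0n eseries0 ?adde0; first by rewrite -(big_nth set0 xpredT).
by move=> i iU _; rewrite nth_default// /hausdorff_weight eqxx.
Qed.

Lemma hausdorff_null_bigcup s (A : nat -> set 'rV[R]_d) :
  (forall l, hausdorff_measure s (A l) = 0%E) ->
  hausdorff_measure s (\bigcup_l A l) = 0%E.
Proof.
move=> A0; apply/hausdorff_nullP => delta eps delta0 eps0.
(* These bounds sum to [eps / 2], which leaves room for the strict inequality. *)
have e20 l : 0 < eps / 2 / (2 ^ l.+1)%:R by rewrite !divr_gt0// ltr0n expn_gt0.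
have /choice[U UA] : forall l, exists U : nat -> set 'rV[R]_d,
    [/\ A l `<=` \bigcup_i U i, forall i, (diam (U i) <= delta%:E)%E &
      (\sum_(0 <= i <oo) hausdorff_weight s (U i) < (eps / 2 / (2 ^ l.+1)%:R)%:E)%E].
  by move=> l; have /hausdorff_nullP := A0 l; apply.
have /ppcard_eqP[f] := card_nat2.
pose g := (f^-1)%FUN.
exists (fun i => U (g i).1 (g i).2); split.
- move=> x [l _ Ax]; have [/(_ x Ax)[i _ Ux] _ _] := UA l.
  by exists (f (l, i)) => //; rewrite /g funK ?inE.
- by move=> i; have [_ h _] := UA (g i).1.
rewrite nneseries_esumT; last by move=> *; exact: hausdorff_weight_ge0.
have -> : \esum_(i in [set: nat]) hausdorff_weight s (U (g i).1 (g i).2) =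
    \esum_(p in [set: nat * nat]) hausdorff_weight s (U p.1 p.2).
  rewrite (reindex_esum [set: nat * nat] [set: nat] f)//.
  by apply: eq_esum => p _; rewrite /g funK ?inE.
rewrite -[X in \esum_(_ in X) _](_ : [set: nat] `*`` (fun=> [set: nat]) = _); last first.
  by apply/seteqP; split.
rewrite -(@esum_esum _ _ _ _ _ (fun i j => hausdorff_weight s (U i j))); last first.
  by move=> *; exact: hausdorff_weight_ge0.
rewrite -nneseries_esumT; last first.
  by move=> l; apply: esum_ge0 => *; exact: hausdorff_weight_ge0.
apply: le_lt_trans (_ : (_ <= (eps / 2)%:E)%E) _; last by rewrite lte_fin; lra.
apply: le_trans (@epsilon_trick0 R (eps / 2) xpredT _); last by lra.
apply: lee_nneseries => [l _ _|l _].
  by apply: esum_ge0 => *; exact: hausdorff_weight_ge0.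
rewrite -nneseries_esumT; last by move=> *; exact: hausdorff_weight_ge0.
by have [_ _ /ltW] := UA l.
Qed.

Lemma hausdorff_dim_le s A : A !=set0 -> 0 <= s -> hausdorff_measure s A = 0%E ->
  (hausdorff_dim A <= s%:E)%E.
Proof.
move=> /set0P/negbTE A0 s0 sA; rewrite /hausdorff_dim A0.
by apply: ereal_inf_lbound; exists s.
Qed.

Lemma hausdorff_dim_ge s A : A !=set0 ->
  (forall t, 0 <= t -> t < s -> hausdorff_measure t A <> 0%E) ->
  (s%:E <= hausdorff_dim A)%E.
Proof.
move=> /set0P/negbTE A0 h; rewrite /hausdorff_dim A0.
apply: le_ereal_inf_tmp => _ [t [t0 tA] <-]; rewrite lee_fin leNgt.
by apply/negP => ts; exact: h tA.
Qed.

End Hausdorff.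

(** * Dimension estimates *)

Lemma powR_exprV (R : realType) (a s : R) k : 0 <= a ->
  (a ^+ k)^-1 `^ s = ((a `^ s) ^+ k)^-1.
Proof.
move=> a0; have powRX (b : R) : 0 <= b -> (b ^+ k) `^ s = (b `^ s) ^+ k.
  by move=> b0; rewrite -(powR_mulrn k b0) -(powR_mulrn k (powR_ge0 b s)) powRAC.
rewrite -exprVn powRX ?invr_ge0// -exprVn; congr (_ ^+ _).
by rewrite -powR_inv1// powRAC powR_inv1// powR_ge0.
Qed.

Section Dimension.
Variables (R : realType) (d n : nat) (D : {set 'rV['I_n]_d}).
Hypothesis hn : (1 < n)%N.
Variable E : set 'rV[R]_d.
Hypothesis hE : fractal_cube D E.
Implicit Types (w u : seq 'rV['I_n]_d) (A V : set 'rV[R]_d).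

(** As [words D m] has no duplicates, [rem] excludes [u] altogether: each block of [m] letters
    leaves [#|D| ^ m - 1] choices. *)
Fixpoint avoiding_words k0 m u j : seq (seq 'rV['I_n]_d) :=
  if j is j'.+1 then
    [seq w ++ v | w <- avoiding_words k0 m u j', v <- rem u (words D m)]
  else words D k0.

Lemma size_avoiding_words k0 m u j : u \in words D m ->
  size (avoiding_words k0 m u j) = (#|D| ^ k0 * (#|D| ^ m).-1 ^ j)%N.
Proof.
move=> um; elim: j => [|j IH] /=; first by rewrite size_words expn0 muln1.
by rewrite size_allpairs IH size_rem// size_words expnSr mulnA.
Qed.

Lemma avoiding_words_sub k0 m u j :
  {subset avoiding_words k0 m u j <= words D (k0 + j * m)}.
Proof.
elim: j => [|j IH] w /=; first by rewrite mul0n addn0.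
move=> /allpairsP[[v v'] [/= /IH vj /mem_rem v'm ->]].
by rewrite mulSnr addnA; exact: cat_words.
Qed.

Section Removable.
Variables (m k0 : nat) (u : seq 'rV['I_n]_d) (A : set 'rV[R]_d).
Hypotheses (m0 : (0 < m)%N) (um : u \in words D m) (AE : A `<=` E).
Hypothesis Au : forall k w z, (k0 <= k)%N -> w \in words D k -> E z ->
  ~ A (cell_map (w ++ u) z).

(** Each point of [A] in the cell of [w] lies in a subcell [w ++ v], and [Au] rules out [v = u]; the
    free prefix makes [w] long enough for [Au]. *)
Lemma avoiding_words_cover j p : A p ->
  exists2 w, w \in avoiding_words k0 m u j & exists2 z, E z & p = cell_map w z.
Proof.
move=> Ap; elim: j => [|j [w wj [z Ez pw]]] /=; first exact: cells_cover (AE Ap).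
have [v vm [z' Ez' zv]] := cells_cover hE m Ez.
have pwv : p = cell_map (w ++ v) z' by rewrite cell_map_cat -zv.
exists (w ++ v); last by exists z'.
apply/allpairsP; exists (w, v); split => //=.
rewrite mem_rem_uniq ?uniq_words// inE vm andbT; apply/eqP => vu.
apply: (Au _ (avoiding_words_sub wj) Ez'); first exact: leq_addr.
by rewrite -vu -pwv.
Qed.

(** The avoiding cells of level [k0 + j * m] cover [A] with total weight at most [C * r ^+ j], where
    [r < 1] is the hypothesis. *)
Lemma removable_null s : 0 <= s ->
  (#|D| ^ m).-1%:R < (n%:R `^ s) ^+ m -> hausdorff_measure s A = 0%E.
Proof.
move=> s0; set M := (_.-1); set q : R := n%:R `^ s => Mq.
have q0 : 0 < q by rewrite powR_gt0// ltr0n; lia.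
apply: hausdorff_null_finite_cover => delta eps delta0 eps0.
pose c : R := Num.sqrt d%:R.
have c0 : 0 <= c by exact: sqrtr_ge0.
pose C := (#|D| ^ k0)%:R * (c `^ s) / q ^+ k0.
have C0 : 0 <= C.
  by rewrite divr_ge0 ?mulr_ge0 ?powR_ge0// exprn_ge0// ltW.
pose r := M%:R / q ^+ m.
have r0 : 0 <= r by rewrite divr_ge0// exprn_ge0// ltW.
have r1 : `|r| < 1.
  by rewrite ger0_norm// ltr_pdivrMr ?exprn_gt0// mul1r.
have eC : 0 < eps / (C + 1) by rewrite divr_gt0// ltr_wpDl.
have [j0 _ j0P] := cvg_expr r1 (nbhsx_ballx 0 _ eC).
have dc : 0 < delta / (c + 1) by rewrite divr_gt0// ltr_wpDl.
have [k1 k1P] := scale_small hn dc.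
pose j := maxn j0 k1; pose K := (k0 + j * m)%N.
have Kk1 : (k1 <= K)%N.
  apply: leq_trans (leq_maxr j0 k1) _; rewrite -/j /K.
  by apply: leq_trans (leq_addl _ _); rewrite leq_pmulr.
have cK0 : 0 <= c * (n%:R ^+ K)^-1 :> R.
  by rewrite mulr_ge0// invr_ge0 ltW// scale_gt0.
have diam_cell w : w \in avoiding_words k0 m u j ->
    (diam (cell_map w @` E) <= (c * (n%:R ^+ K)^-1)%:E)%E.
  move=> wj; apply: diam_le => _ _ [z Ez <-] [z' Ez' <-].
  apply: eucl_dist_le => [|i]; first by rewrite invr_ge0 ltW// scale_gt0.
  exact: (cell_diam hn hE i (avoiding_words_sub wj)).
exists [seq cell_map w @` E | w <- avoiding_words k0 m u j]; split.
- move=> p /(avoiding_words_cover j)[w wj [z Ez ->]].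
  by exists (cell_map w @` E); [exact: map_f|exists z].
- move=> _ /mapP[w wj ->]; apply: le_trans (diam_cell w wj) _.
  rewrite lee_fin; have := k1P _ Kk1; rewrite ltr_pdivlMr ?ltr_wpDl//.
  have : 0 < (n%:R ^+ K)^-1 :> R by rewrite invr_gt0 scale_gt0.
  by move: (_^-1) => a a0; nra.
rewrite big_map big_seq_cond.
apply: (@le_lt_trans _ _ (\sum_(w <- avoiding_words k0 m u j)
    ((c * (n%:R ^+ K)^-1) `^ s)%:E)%E).
  rewrite [leRHS]big_seq_cond; apply: lee_sum => w; rewrite andbT => wj.
  exact: hausdorff_weight_le (diam_cell w wj).
rewrite sumEFin lte_fin big_const_seq count_predT iter_addr_0.
rewrite size_avoiding_words// -/M.
rewrite powRM// ?invr_ge0 ?exprn_ge0// powR_exprV// -/q -mulr_natl.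
have -> : (#|D| ^ k0 * M ^ j)%:R * (c `^ s * (q ^+ K)^-1) = C * r ^+ j.
  rewrite /C /r /K natrM (natrX _ M) expr_div_n exprD mulnC exprM.
  by field; rewrite !expf_neq0 ?gt_eqF.
have := j0P j (leq_maxl _ _); rewrite /preimage /ball /= sub0r normrN ger0_norm ?exprn_ge0//.
rewrite ltr_pdivlMr ?ltr_wpDl// mulrC; apply: le_lt_trans.
by rewrite ler_wpM2r ?exprn_ge0// lerDl.
Qed.

End Removable.

(** * Lower bound for the dimension by counting cells *)

Section LowerBound.

(** Codes of two such cells differ by at most [4] in each coordinate: [3] from the size of [V] and
    [1] from the positions inside the cells. This leaves [9] values around [v0]. *)
Lemma cells_meeting_bound k V : (forall p p' i, V p -> V p' ->
    `|p ord0 i - p' ord0 i| <= 3 / n%:R ^+ k) ->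
  (size [seq v <- words D k | `[< exists2 z, E z & V (cell_map v z) >]] <= 9 ^ d)%N.
Proof.
move=> Vk; set L := (X in size X).
have uL : uniq L by rewrite filter_uniq ?uniq_words.
have [L0|[v0 v0L]] : L = [::] \/ exists v0, v0 \in L.
  by case: L {uL} => [|v L]; [left|right; exists v; rewrite mem_head].
  by rewrite L0.
have memL v : v \in L -> v \in words D k /\ exists2 z, E z & V (cell_map v z).
  by rewrite mem_filter => /andP[/asboolP ? ?].
have close v i : v \in L -> (code v i <= code v0 i + 4)%N /\ (code v0 i <= code v i + 4)%N.
  move=> /memL[vk [z Ez Vz]]; have [v0k [z0 Ez0 Vz0]] := memL v0 v0L.
  have := Vk _ _ i Vz Vz0; rewrite !cell_mapE//.
  rewrite (size_mem_words vk) (size_mem_words v0k) -mulrBl normrM.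
  rewrite (gtr0_norm (_ : 0 < _^-1)) ?invr_gt0 ?scale_gt0//.
  rewrite ler_pM2r ?invr_gt0 ?scale_gt0// ler_norml => /andP[h1 h2].
  have /andP[? ?] := fractal_cube_itv hn hE i Ez.
  have /andP[? ?] := fractal_cube_itv hn hE i Ez0.
  by split; rewrite -(ler_nat R) natrD; lra.
(* The shift by [4] keeps the natural-number subtraction from truncating. *)
pose f (v : seq 'rV['I_n]_d) : {ffun 'I_d -> 'I_9} :=
  [ffun i => inord (code v i + 4 - code v0 i)%N].
have fL : {in L &, injective f}.
  move=> v v' vL v'L /ffunP e; apply: code_inj.
    by rewrite (size_mem_words (memL v vL).1) (size_mem_words (memL v' v'L).1).
  move=> i; have := e i; rewrite !ffunE => /(congr1 (@nat_of_ord 9)).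
  have := close v i vL; have := close v' i v'L.
  by move=> [? ?] [? ?]; rewrite !inordK; lia.
have ufL : uniq (map f L) by rewrite map_inj_in_uniq.
rewrite -(size_map f) -(card_uniqP ufL); apply: leq_trans (max_card _) _.
by rewrite card_ffun !card_ord.
Qed.

(** The prefix of length [k] of a counted word addresses a cell meeting [V], and has
    [#|D| ^ (K - k)] extensions. *)
Lemma count_cells_meeting k K V x : E x -> (k <= K)%N ->
  (forall p p' i, V p -> V p' -> `|p ord0 i - p' ord0 i| <= 3 / n%:R ^+ k) ->
  (count (fun w => `[< V (cell_map w x) >]) (words D K) <=
     9 ^ d * #|D| ^ (K - k))%N.
Proof.
move=> Ex kK Vk; rewrite -size_filter.
set L := [seq v <- words D k | `[< exists2 z, E z & V (cell_map v z) >]].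
apply: (@leq_trans (size [seq v ++ v' | v <- L, v' <- words D (K - k)])).
  apply: uniq_leq_size; first by rewrite filter_uniq ?uniq_words.
  move=> w; rewrite mem_filter => /andP[/asboolP Vw wK].
  have := wK; rewrite mem_words => /andP[/eqP sw].
  rewrite -{1}(cat_take_drop k w) all_cat => /andP[tD dD].
  apply/allpairsP; exists (take k w, drop k w); split; last by rewrite cat_take_drop.
    rewrite mem_filter /= mem_words tD size_takel ?sw// eqxx !andbT.
    apply/asboolP; exists (cell_map (drop k w) x); first exact: (cell_sub hE).
    by rewrite -cell_map_cat cat_take_drop.
  by rewrite mem_words /= dD size_drop sw eqxx.
by rewrite size_allpairs size_words leq_mul2r cells_meeting_bound ?orbT.
Qed.

Hypothesis hD : (1 < #|D|)%N.
Variable t : R.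
Hypotheses (t0 : 0 <= t) (tD : n%:R `^ t <= #|D|%:R).

Let C : R := n%:R `^ t.

Let C0 : 0 < C. Proof. by rewrite powR_gt0// ltr0n; lia. Qed.

(** For positive diameter, [k] is least with [n^-(k+1) < diam U]; then
    [#|D|^-k <= C^-k <= C * (diam U)^t]. *)
Lemma scale_of_diam (U : set 'rV[R]_d) (eta : R) :
  0 < eta -> (diam U <= 1%:E)%E -> exists k,
    (forall p p' i, U p -> U p' -> `|p ord0 i - p' ord0 i| <= (n%:R ^+ k)^-1) /\
    (((#|D|%:R ^+ k)^-1)%:E <= C%:E * hausdorff_weight t U + eta%:E)%E.
Proof.
move=> eta0 U1.
have pU p p' i : U p -> U p' -> ((`|p ord0 i - p' ord0 i|)%:E <= diam U)%E.
  move=> Up Up'; apply: le_trans (eucl_dist_le_diam Up Up').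
  by rewrite lee_fin coord_le_eucl_dist.
(* Empty sets and singletons have no scale of their own; [k] is taken large and charged to [eta]. *)
have [Udeg|U0] := leP (diam U) 0%E.
  have [k /(_ k (leqnn _)) ke] := scale_small hD eta0.
  exists k; split=> [p p' i Up Up'|].
    rewrite -lee_fin; apply: le_trans (pU p p' i Up Up') _; apply: le_trans Udeg _.
    by rewrite lee_fin invr_ge0 ltW// scale_gt0.
  apply: (@le_trans _ _ eta%:E); first by rewrite lee_fin ltW.
  by rewrite leeDr// mule_ge0 ?hausdorff_weight_ge0// lee_fin ltW.
have Un0 : (U == set0) = false.
  by apply/negbTE/negP => /eqP U0'; move: U0; rewrite U0' diam_set0.
rewrite /hausdorff_weight Un0.
move: U0 U1 pU; case: (diam U) => [r| |]//=; rewrite lte_fin lee_fin => r0 r1 pU.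
have exk : exists k, ((n%:R ^+ k.+1)^-1 < r).
  have [k kP] := scale_small hn r0; exists k; exact: kP.
case: (ex_minnP exk) => k kr mink; exists k; split=> [p p' i Up Up'|].
  have := pU p p' i Up Up'; rewrite lee_fin => /le_trans; apply.
  case: k {kr} mink => [_|k mink]; first by rewrite expr0 invr1.
  by rewrite leNgt; apply/negP => /mink; rewrite ltnn.
rewrite -EFinM -EFinD lee_fin -[leLHS]addr0.
apply: lerD; last exact: ltW.
have : ((n%:R ^+ k.+1)^-1) `^ t <= r `^ t.
  by apply: ge0_ler_powR; rewrite // ?nnegrE ltW ?invr_gt0 ?scale_gt0.
rewrite powR_exprV// -/C exprS invfM => h.
have : (C ^+ k)^-1 <= C * r `^ t.
  by move: h; rewrite mulrC ler_pdivrMr// mulrC.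
apply: le_trans; rewrite lef_pV2 ?posrE ?exprn_gt0//.
  by apply: lerXn2r; rewrite ?nnegrE ?ler0n ?(ltW C0).
by apply: lt_le_trans tD.
Qed.

(* Mass distribution: a set of diameter about [n^-k] meets at most [9^d] cells
   of level [k], a fraction [9^d / #|D|^k] of all cells of any finer level. *)
Lemma fractal_cube_not_null : hausdorff_measure t E <> 0%E.
Proof.
move=> /hausdorff_nullP null.
pose B : R := 9 ^+ d.
have B0 : 0 < B by rewrite exprn_gt0.
(* With this [eps], the weights times [C] contribute less than [(2 * B)^-1], and the errors [eta] at
   most as much, so that [B] times the total is below [1]. *)
have eps0 : 0 < (2 * B * C)^-1 by rewrite invr_gt0 !mulr_gt0.
have [U [EU U1 Ueps]] := null 1 _ ltr01 eps0.
have eta0 i : 0 < (2 * B)^-1 / (2 ^ i.+1)%:R :> R.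
  by rewrite divr_gt0 ?invr_gt0 ?mulr_gt0// ltr0n expn_gt0.
have /choice[kk kkP] := fun i => scale_of_diam (eta0 i) (U1 i).
have s0 k : 0 < (n%:R ^+ k)^-1 :> R by rewrite invr_gt0 scale_gt0.
(* Open thickenings allow a finite subcover; they stretch the width to at most [3 / n^kk]. *)
pose V i := \bigcup_(p in U i) (ball p (n%:R ^+ kk i)^-1)°.
have Vk i p p' j : V i p -> V i p' -> `|p ord0 j - p' ord0 j| <= 3 / n%:R ^+ kk i.
  move=> [q Uq /interior_subset /(ball_rowP _ _ (s0 _))/(_ j) qp].
  move=> [q' Uq' /interior_subset /(ball_rowP _ _ (s0 _))/(_ j) qp'].
  have := (kkP i).1 q q' j Uq Uq'; move: (s0 (kk i)) qp qp'.
  move: (_^-1) => a a0; rewrite !ltr_norml !ler_norml.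
  by move=> /andP[? ?] /andP[? ?] /andP[? ?]; apply/andP; split; lra.
have cE : cover_compact E by rewrite -compact_cover; case: hE.
have [|p Ep|F _ FE] := cE nat setT V.
- by move=> i _; apply: bigcup_open => p _; exact: open_interior.
- have [i _ Up] := EU p Ep; exists i => //; exists p => //.
  by rewrite /interior; exact: nbhsx_ballx.
have [x Ex] : E !=set0 by case: hE.
pose M := (\max_(i <- finmap.enum_fset F) i)%N.+1.
pose K := (\max_(i < M) kk i)%N.
have kkK (i : 'I_M) : (kk i <= K)%N by exact: leq_bigmax.
have cover_words w : w \in words D K ->
    (1 <= \sum_(i < M) (`[< V i (cell_map w x) >] : nat))%N.
  move=> wK; have [i /= iF Vi] := FE _ (words_cell_sub hE wK Ex).
  have iM : (i < M)%N by rewrite ltnS; exact: (@leq_bigmax_seq _ _ xpredT id i iF).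
  by rewrite (bigD1 (Ordinal iM))//= (asboolT Vi).
(* Double counting of pairs of a level-[K] cell and a [V i] containing its sample point, the image
   of [x]. *)
have count_words : (#|D| ^ K <= \sum_(i < M) 9 ^ d * #|D| ^ (K - kk i))%N.
  rewrite -size_words -sum1_size.
  apply: (@leq_trans (\sum_(w <- words D K) \sum_(i < M)
      (`[< V i (cell_map w x) >] : nat))).
    by rewrite big_seq [leqRHS]big_seq; apply: leq_sum => w; exact: cover_words.
  rewrite exchange_big; apply: leq_sum => i _.
  apply: leq_trans (count_cells_meeting Ex (kkK i) (Vk i)).
  by rewrite -sum1_count [leqRHS]big_mkcond; apply: leq_sum => w _; case: asbool.
have N0 : 0 < #|D|%:R :> R by rewrite ltr0n; lia.
have mass : 1 <= B * \sum_(i < M) (#|D|%:R ^+ kk i)^-1.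
  rewrite -(ler_pM2l (exprn_gt0 K N0)) mulr1 -natrX.
  apply: le_trans (_ : (\sum_(i < M) 9 ^ d * #|D| ^ (K - kk i))%:R <= _).
    by rewrite ler_nat.
  rewrite natr_sum !mulr_sumr; apply: ler_sum => i _.
  rewrite natrM !natrX -(subnK (kkK i)) addnK exprD -/B le_eqVlt; apply/orP; left.
  by apply/eqP; field; rewrite expf_neq0 ?gt_eqF.
have : ((\sum_(i < M) (#|D|%:R ^+ kk i)^-1)%:E <
    ((2 * B)^-1 + (2 * B)^-1)%:E)%E.
  rewrite -sumEFin EFinD.
  apply: (@le_lt_trans _ _ (\sum_(i < M) (C%:E * hausdorff_weight t (U i)) +
      \sum_(i < M) ((2 * B)^-1 / (2 ^ i.+1)%:R)%:E)%E).
    by rewrite -big_split; apply: lee_sum => i _; exact: (kkP i).2.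
  apply: lte_leD; first by rewrite sumEFin.
    rewrite -ge0_sume_distrr; last by move=> *; exact: hausdorff_weight_ge0.
    have -> : (2 * B)^-1 = C * (2 * B * C)^-1.
      by field; rewrite !gt_eqF.
    rewrite EFinM lte_pmul2l//; apply: le_lt_trans Ueps.
    rewrite -(big_mkord xpredT (fun i => hausdorff_weight t (U i))).
    by apply: nneseries_lim_ge => *; exact: hausdorff_weight_ge0.
  apply: le_trans (@epsilon_trick0 R (2 * B)^-1 xpredT _); last first.
    by rewrite invr_ge0 ltW ?mulr_gt0.
  rewrite -(big_mkord xpredT (fun i => ((2 * B)^-1 / (2 ^ i.+1)%:R)%:E)).
  by apply: nneseries_lim_ge => i _ _; rewrite lee_fin ltW.
rewrite lte_fin -(ltr_pM2l B0) => /(le_lt_trans mass).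
have -> : B * ((2 * B)^-1 + (2 * B)^-1) = 1 by field; rewrite gt_eqF.
by rewrite ltxx.
Qed.

End LowerBound.

End Dimension.

(** * Comparison of the two dimensions *)

Lemma powR_ln_div (R : realType) (a b : R) : 1 < a -> 0 < b ->
  a `^ (ln b / ln a) = b.
Proof.
move=> a1 b0; have a0 : 0 < a by exact: lt_trans a1.
by rewrite /powR gt_eqF// divfK ?gt_eqF ?ln_gt0// lnK.
Qed.

Lemma nontrivial_points_bigcup (R : realType) (d : nat) (E : set 'rV[R]_d) :
  E `\` trivial_points E = \bigcup_l [set p | E p /\ exists q i,
    connected_component E p q /\ l.+1%:R^-1 < `|p ord0 i - q ord0 i|].
Proof.
apply/seteqP; split=> [p [Ep ntp]|p [l _ [Ep [q [i [Cq]]]]]]; last first.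
  move=> pq; split => // tp; move: Cq; rewrite tp => /= qp.
  by move: pq; rewrite qp subrr normr0 ltNge invr_ge0 ler0n.
have [q Cq qp] : exists2 q, connected_component E p q & q <> p.
  apply: contrapT => h; apply: ntp; apply/seteqP; split=> [q Cq|_ ->].
    by apply: contrapT => qp; apply: h; exists q.
  exact: connected_component_refl.
have [i piqi] : exists i, p ord0 i <> q ord0 i.
  by apply/existsNP => e; apply: qp; apply/rowP => i; rewrite e.
have pq0 : 0 < `|p ord0 i - q ord0 i| by rewrite normr_gt0 subr_eq0; apply/eqP.
exists (Num.bound `|p ord0 i - q ord0 i|^-1) => //; split => //.
exists q, i; split => //; rewrite invf_plt ?posrE ?ltr0n//.
apply: lt_trans (archi_boundP _) _; first by rewrite invr_ge0 ltW.
by rewrite ltr_nat.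
Qed.

Theorem theorem1p1 (R : realType) (d n : nat) (hd : (1 <= d)%N) (hn : (2 <= n)%N)
    (D : {set 'rV['I_n]_d}) (hD : D != finset.set0)
    (E : set 'rV[R]_d) (hE : fractal_cube D E)
    (htriv : trivial_points E !=set0) :
  (connectedness_index E < hausdorff_dim E)%E.
Proof.
have E0 : E !=set0 by case: hE.
have [m [u um small_u]] := removable_word hn hE htriv.
rewrite /connectedness_index.
have [->|/set0P[p ntp]] := eqVneq (E `\` trivial_points E) set0.
  apply: (@lt_le_trans _ _ 0%:E); first by rewrite /hausdorff_dim eqxx lte_fin ltrN10.
  by apply: hausdorff_dim_ge => // t t0; rewrite ltNge t0.
pose A l := [set p | E p /\ exists q i,
  connected_component E p q /\ (l.+1%:R^-1 : R) < `|p ord0 i - q ord0 i|].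
have AE l : A l `<=` E by move=> ? [].
have Au l : exists k0, forall k w z, (k0 <= k)%N -> w \in words D k -> E z ->
    ~ A l (cell_map (w ++ u) z).
  have [|k0 k0P] := @scale_small R n hn l.+1%:R^-1; first by rewrite invr_gt0.
  exists k0 => k w z /k0P kl wk Ez [_ [q [i [Cq]]]].
  by rewrite ltNge (le_trans (small_u k w z q i wk Ez Cq))// ltW.
(* A nontrivial point has an avoiding address, so [#|D| ^ m - 1] is positive; this gives [m > 0] and
   [#|D| > 1]. *)
have M2 : (1 < #|D| ^ m)%N.
  move: (ntp); rewrite nontrivial_points_bigcup => -[l _ Alp].
  have [k0 k0P] := Au l.
  have [w w1 _] := avoiding_words_cover hE m (@AE l) k0P 1 Alp.
  have : (0 < size (avoiding_words D k0 m u 1))%N by case: avoiding_words w1.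
  by rewrite size_avoiding_words// expn1 muln_gt0 => /andP[_]; lia.
have m0 : (0 < m)%N by case: m M2 {um small_u Au}.
have D1 : (1 < #|D|)%N.
  by move: M2; case: #|D| => [|[|//]]; rewrite ?exp0n// exp1n.
have n1 : 1 < n%:R :> R by rewrite ltr1n.
have nm1 : 1 < n%:R ^+ m :> R by rewrite exprn_egt1// -lt0n.
(* Any number strictly between [#|D| ^ m - 1] and [#|D| ^ m] that exceeds [1] would do: the lower
   bound makes every stage [s]-null, the upper one gives [s < s1]. *)
pose b : R := (#|D| ^ m)%:R - 2^-1.
have b1 : 1 < b.
  have : 2 <= (#|D| ^ m)%:R :> R by rewrite (ler_nat R 2).
  by rewrite /b; lra.
have b0 : 0 < b by exact: lt_trans b1.
pose s := ln b / ln (n%:R ^+ m).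
have sm : (n%:R `^ s) ^+ m = b.
  rewrite -powR_mulrn ?powR_ge0// powRAC powR_mulrn//.
  exact: powR_ln_div.
have s0 : 0 <= s by rewrite divr_ge0// ltW// ln_gt0.
pose s1 : R := ln #|D|%:R / ln n%:R.
apply: (@le_lt_trans _ _ s%:E).
  apply: hausdorff_dim_le => //; first by exists p.
  rewrite nontrivial_points_bigcup; apply: hausdorff_null_bigcup => l.
  have [k0 k0P] := Au l; apply: (removable_null hn hE m0 um (@AE l) k0P s0).
  by rewrite sm /b -subn1 natrB ?(ltnW M2)//; lra.
apply: (@lt_le_trans _ _ s1%:E).
  rewrite lte_fin /s /s1 lnXn ?(lt_trans ltr01)// ltr_pdivrMr; last first.
    by rewrite pmulrn_lgt0// ln_gt0.
  rewrite mulrnAr divfK ?gt_eqF ?ln_gt0// -lnXn ?ltr0n ?(ltnW D1)// -natrX.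
  by rewrite ltr_ln ?posrE// ?ltr0n ?(ltnW M2)// /b; lra.
apply: hausdorff_dim_ge => // t t0 ts1.
apply: (fractal_cube_not_null hn hE D1 t0).
rewrite -[leRHS](@powR_ln_div R n%:R) ?ltr0n ?(ltnW D1)//.
by apply: ler_powR; rewrite ltW.
Qed.
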